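(* For fixed sample $M$ of $m$ users, the Laplace Density Estimator provides an unbiased estimate $\tilde d$ of the density $d(\mathcal{S}_M)$ of $\mathcal{S}_M$ and has mean squared error $$\mathbb{E}\bigl[(\tilde d-d(\mathcal{S}_M))^2\bigr]=\frac{2(m+1)}{m^2\varepsilon^2}.$$
   Context: Streams: $\mathcal{U}$ is a finite universe of users; a data stream is a finite sequence $\mathcal{S}=(s_1,\dots,s_T)$ with $s_t\in\mathcal{U}$. For a set $M\subseteq\mathcal{U}$ of $m$ users, $\mathcal{S}_M$ is the subsequence of $\mathcal{S}$ consisting of the updates $s_t\in M$, and its density $d(\mathcal{S}_M)$ is the fraction of the $m$ users of $M$ that appear in it (at least once). $\mathrm{Laplace}(\mu,s)$ denotes a random variable with density $\frac1{2s}e^{-|x-\mu|/s}$. Laplace Density Estimator (privacy parameter $0<\varepsilon\le\frac12$, sample size $m$): sample a random subset $M\subseteq\mathcal{U}$ of $m$ users without replacement, ordered as $M[1],\dots,M[m]$; pick arbitrary reals $\mu_{init}<\mu_{upd}$ and set $b=\frac{\mu_{upd}-\mu_{init}}{\varepsilon}$; keep an array of reals $\mathbf{x}=[x_1\ \dots\ x_m]$, with entries initialized independently as $x_i\sim\mathrm{Laplace}(\mu_{init},b)$. For $t=1,\dots,T$: if $s_t=M[i]$ for some $i$, re-sample $x_i\sim\mathrm{Laplace}(\mu_{upd},b)$ (with fresh randomness). At the end output $$\tilde d=\frac1{\mu_{upd}-\mu_{init}}\Bigl(\frac1m\sum_{i=1}^m x_i-\mu_{init}\Bigr)+\mathrm{Laplace}\bigl(0,\tfrac1{\varepsilon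 m}\bigr),$$ with the last term independent of everything else. The expectation is over the array entries and the final Laplace noise, with $\mathcal{S}$ and $M$ fixed. *)

(* Defs.v *)
From HB Require Import structures.
From mathcomp Require Import all_boot all_order all_algebra.
From mathcomp Require Import all_classical all_reals all_analysis.

Set Implicit Arguments.
Unset Strict Implicit.
Unset Printing Implicit Defensive.

Import Order.TTheory GRing.Theory Num.Theory.
Import numFieldNormedType.Exports.

Local Open Scope classical_set_scope.
Local Open Scope ring_scope.

Definition substream (U : finType) (M S : seq U) : seq U :=
  [seq u <- S | u \in M].

(* Each user of [M] is counted once, however often it appears in the stream. *)
Definition density (R : realType) (U : finType) (m : nat)
    (M : m.-tuple U) (S : seq U) : R :=
  #|[set u in M | u \in substream M S]%SET|%:R / m%:R.

Definition laplace_pdf (R : realType) (mu s x : R) : R :=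
  (2 * s)^-1 * expR (- (`|x - mu| / s)).

Definition laplace_law (R : realType) (mu s : R) (A : set R) : \bar R :=
  (\int[lebesgue_measure]_(x in A) (laplace_pdf mu s x)%:E)%E.

Definition is_laplace (d : measure_display) (Omega : measurableType d)
    (R : realType) (P : probability Omega R) (X : {RV P >-> R}) (mu s : R) :
    Prop :=
  forall A : set R, measurable A -> distribution P X A = laplace_law mu s A.

Definition mutually_independent (d : measure_display)
    (Omega : measurableType d) (R : realType) (P : probability Omega R)
    (I : finType) (X : I -> {RV P >-> R}) : Prop :=
  forall (J : {set I}) (B : I -> set R),
    (forall i, i \in J -> measurable (B i)) ->
    P (\bigcap_(i in [set` J]) (X i @^-1` B i)) =
    (\prod_(i in J) P (X i @^-1` B i))%E.

(* The value [upd t] is the fresh draw available at step [t]; it is used only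
   when the user arriving at step [t] belongs to the sample. *)
Definition resample (R : realType) (U : finType) (T m : nat)
    (S : T.-tuple U) (M : m.-tuple U) (upd : 'I_T -> R)
    (x : 'I_m -> R) (t : 'I_T) : 'I_m -> R :=
  fun i => if tnth S t == tnth M i then upd t else x i.

Definition final_array (R : realType) (U : finType) (T m : nat)
    (S : T.-tuple U) (M : m.-tuple U)
    (init : 'I_m -> R) (upd : 'I_T -> R) : 'I_m -> R :=
  foldl (resample S M upd) init (enum 'I_T).

Definition laplace_density_estimator (R : realType) (U : finType) (T m : nat)
    (S : T.-tuple U) (M : m.-tuple U) (mu_init mu_upd : R)
    (init : 'I_m -> R) (upd : 'I_T -> R) (noise : R) : R :=
  (mu_upd - mu_init)^-1 *
    (m%:R^-1 * (\sum_(i < m) final_array S M init upd i) - mu_init) + noise.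

(* All the random draws of the algorithm as one family: the initial values,
   the per-step draws, and the final noise. *)
Definition all_draws (T m : nat) (V : Type)
    (init : 'I_m -> V) (upd : 'I_T -> V) (noise : V)
    (k : 'I_m + 'I_T + unit) : V :=
  match k with
  | inl (inl i) => init i
  | inl (inr t) => upd t
  | inr _ => noise
  end.

(* Main.v *)
From HB Require Import structures.
Require Import Defs.
From mathcomp Require Import all_boot all_order all_algebra.
From mathcomp Require Import all_classical all_reals all_analysis.
From mathcomp Require Import measurable_realfun ring lra.

Import Order.TTheory GRing.Theory Num.Theory.
Import numFieldNormedType.Exports.

Local Open Scope ring_scope.

(** Resampling replaces the entry of a sampled user by its last draw, so the
    final array consists of [m] distinct members of the independent family of
    draws, with mean [mu_upd] exactly when the user occurs in the stream.
    Linearity of expectation gives unbiasedness.  Since independent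
    square-integrable variables are uncorrelated and a Laplace variable of scale
    [s] has variance [2 s^2], the variance of the estimate is
    [m * 2 b^2 / (m (mu_upd - mu_init))^2 + 2 / (eps m)^2]. *)

(** * Integration against a measure given by a density *)

Section density_change_of_variables.
Local Open Scope classical_set_scope.
Local Open Scope ereal_scope.
Context {d} {T : measurableType d} {R : realType}.
Variables (nu mu : {measure set T -> \bar R}) (g : T -> R).
Hypotheses (mg : measurable_fun setT g) (g0 : forall x, (0 <= g x)%R).
Hypothesis nuE : forall A, measurable A -> nu A = \int[mu]_(x in A) (g x)%:E.

Import HBNNSimple.

(** On indicators this is [nuE]; linearity extends it to simple functions, and monotone convergence
    along the increasing simple approximations of [f] to all nonnegative measurable functions. *)
Lemma ge0_integral_density (f : T -> \bar R) :
  measurable_fun setT f -> (forall x, 0 <= f x) ->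
  \int[nu]_x f x = \int[mu]_x (f x * (g x)%:E).
Proof.
move=> mf f0.
have mgE : measurable_fun setT (EFin \o g) by exact/measurable_EFinP.
pose h := nnsfun_approx measurableT mf.
have h_cvg x : (h n x)%:E @[n --> \oo]%classic --> f x.
  by apply: cvg_nnsfun_approx.
have h_homo x : {homo (fun n => (h n x)%:E) : m n / (m <= n)%N >-> m <= n}.
  by move=> m n mn; rewrite lee_fin; exact/lefP/nd_nnsfun_approx.
have -> : \int[nu]_x f x = lim (\int[nu]_x (h n x)%:E @[n --> \oo]%classic).
  rewrite (eq_integral (fun x => limn (fun n => (h n x)%:E))); last first.
    by move=> x _; exact/esym/cvg_lim.
  apply: monotone_convergence => //.
  - by move=> n; exact/measurable_EFinP/measurable_funP.
  - by move=> n x _; rewrite lee_fin.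
have -> : \int[mu]_x (f x * (g x)%:E) =
    lim (\int[mu]_x ((h n x)%:E * (g x)%:E) @[n --> \oo]%classic).
  rewrite (eq_integral (fun x => limn (fun n => (h n x)%:E * (g x)%:E))).
    apply: monotone_convergence => //.
  - by move=> n; apply: emeasurable_funM => //; exact/measurable_EFinP.
  - by move=> n x _; rewrite mule_ge0 ?lee_fin.
  - by move=> x _ m n mn; rewrite lee_wpmul2r ?lee_fin ?g0//; exact: h_homo.
  move=> x _; apply/esym/cvg_lim => //.
  by apply: cvgeZr => //; exact: h_cvg.
congr (limn _); apply/funext => n; rewrite integralT_nnsfun sintegralE.
(* Only the simple function [h n] remains: it is split over its finitely many values, each level set
   being handled by [nuE]. *)
transitivity (\int[mu]_x \sum_(y \in range (h n))
    ((y * \1_(h n @^-1` [set y]) x)%:E * (g x)%:E)); last first.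
  apply: eq_integral => x _; rewrite -ge0_mule_fsuml.
    by rewrite fsumEFin // -fimfunE.
  by move=> y; exact: nnfun_muleindic_ge0.
rewrite ge0_integral_fsum//; last 2 first.
- move=> y; apply: emeasurable_funM => //; apply/measurable_EFinP.
  exact: measurable_funM.
- by move=> y x _; rewrite mule_ge0 ?lee_fin// -lee_fin EFinM nnfun_muleindic_ge0.
apply: eq_fsbigr => r /[!inE] -[t _ <-].
have mA : measurable (h n @^-1` [set h n t]) by [].
rewrite nuE// -ge0_integralZl//; last 3 first.
- exact: measurable_funTS.
- by move=> x _; rewrite lee_fin.
- by rewrite lee_fin.
rewrite integral_mkcond; apply: eq_integral => x _.
rewrite patchE indicE; case: (_ \in _) => /=.
  by rewrite mulr1.
by rewrite mulr0 mul0e.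
Qed.

End density_change_of_variables.

(** * The Laplace density and its standardization *)

Section laplace_moments.
Local Open Scope classical_set_scope.
Context {R : realType}.
Local Notation mu := (@lebesgue_measure R).

Lemma continuous_laplace_pdf (m s : R) : continuous (laplace_pdf m s).
Proof.
move=> x; rewrite /laplace_pdf.
apply: (@continuousM _ R^o (fun=> (2 * s)^-1) (fun x => expR (- (`|x - m| / s)))).
  exact: cst_continuous.
apply: continuous_comp; last exact: continuous_expR.
apply: (@continuousN _ R^o).
apply: (@continuousM _ R^o (fun x => `|x - m|) (fun=> s^-1)); last first.
  exact: cst_continuous.
apply: (@continuous_comp _ _ _ (fun x => x - m) Num.norm); last exact: norm_continuous.
by apply: (@continuousB _ R^o _ id (fun=> m)); [exact: cvg_id|exact: cst_continuous].
Qed.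

Lemma laplace_pdf_ge0 (m s x : R) : 0 < s -> 0 <= laplace_pdf m s x.
Proof. by move=> s0; rewrite /laplace_pdf mulr_ge0 ?expR_ge0// invr_ge0 mulr_ge0 ?ltW. Qed.

(** Substitute [x = m + s * y]: the derivative [s] cancels the factor [s^-1] of the density. Every
    moment computation thus reduces to location 0 and scale 1. *)
Lemma ge0_integral_laplace_standardize (f : R -> R) (m s : R) :
  0 < s -> continuous f -> (forall x, 0 <= f x) ->
  (\int[mu]_x (f ((x - m) / s) * laplace_pdf m s x)%:E =
   \int[mu]_y (f y * laplace_pdf 0 1 y)%:E)%E.
Proof.
move=> s0 cf f0.
pose F (y : R) : R := m + s * y.
have isdF (y : R) : is_derive y 1 F s.
  by rewrite /F; apply: trigger_derive; rewrite /GRing.scale/= add0r mul1r mulr1.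
have F'E : F^`() = cst s by apply/funext => y; rewrite derive1E derive_val.
have cg : continuous (fun x => (x - m) / s).
  move=> x; apply: (@continuousM _ R^o (fun x => x - m) (fun=> s^-1)); last first.
    exact: cst_continuous.
  by apply: (@continuousB _ R^o _ id (fun=> m)); [exact: cvg_id|exact: cst_continuous].
rewrite (@increasing_ge0_integration_by_substitutionT _ F).
- apply: eq_integral => y _; congr EFin; rewrite F'E.
  change (f ((F y - m) / s) * laplace_pdf m s (F y) * s = f y * laplace_pdf 0 1 y).
  have FyE : F y - m = s * y by rewrite /F addrAC subrr add0r.
  rewrite /laplace_pdf FyE subr0 divr1 normrM (gtr0_norm s0).
  have sK (z : R) : s * z / s = z by rewrite mulrAC divff ?mul1r// gt_eqF.
  by rewrite !sK mulr1 invfM; field; rewrite gt_eqF.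
- by move=> x y xy; rewrite /F ltrD2l ltr_pM2l.
- by rewrite F'E; exact: cst_continuous.
- by rewrite F'E; exact: is_cvg_cst.
- by rewrite F'E; exact: is_cvg_cst.
- by move=> x; exact: ex_derive.
- apply/cvgrNyPle => A.
  apply: filterS (nbhs_ninfty_le (num_real ((A - m) / s))) => x.
  by rewrite ler_pdivlMr// mulrC lerBrDl.
- apply/cvgryPge => A.
  apply: filterS (nbhs_pinfty_ge (num_real ((A - m) / s))) => x.
  by rewrite ler_pdivrMr// mulrC lerBlDl.
- move=> x; apply: (@continuousM _ R^o (fun x => f ((x - m) / s))).
    by apply: (@continuous_comp _ _ _ (fun x => (x - m) / s)); [exact: cg|exact: cf].
  exact: continuous_laplace_pdf.
- by move=> x; rewrite mulr_ge0// laplace_pdf_ge0.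
Qed.

End laplace_moments.

(** * Second moment and symmetry of the standard Laplace density *)

Section laplace_standard_moments.
Local Open Scope classical_set_scope.
Context {R : realType}.
Local Notation mu := (@lebesgue_measure R).

Lemma quadratic_expRN_cvg0 :
  (x ^+ 2 / 2 + x + 1) * expR (- x) @[x --> +oo] --> (0 : R).
Proof.
apply/cvgrPdist_lt => /= e e0.
(* For [x >= 1] the quadratic is at most [5 / 2 * x ^+ 2]. The bound [expR x >= 1 + x ^+ 3 / 6]
   beats this after scaling by [e] once [e * x / 6 >= 5 / 2], that is [x >= 15 / e]. *)
apply: filterS2 (nbhs_pinfty_ge (num_real (1 : R)))
  (nbhs_pinfty_ge (num_real (15 / e))) => x x1 xe.
have x0 : 0 < x by rewrite (lt_le_trans ltr01).
rewrite sub0r normrN ger0_norm ?mulr_ge0 ?expR_ge0 ?addr_ge0 ?divr_ge0 ?sqr_ge0 ?ltW//.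
rewrite expRN ltr_pdivrMr ?expR_gt0//.
apply: (@lt_le_trans _ _ (e * (1 + x ^+ 3 / 6))); last first.
  by rewrite ler_pM2l//; exact: (expR_ge1Dxn 2 (ltW x0)).
move: xe; rewrite ler_pdivrMr// => xe.
have : 15 * x ^+ 2 <= x * e * x ^+ 2 by rewrite ler_wpM2r// sqr_ge0.
rewrite [x ^+ 3]exprS expr2.
nra.
Qed.

Lemma integral_itv_sqr_expRN :
  (\int[mu]_(x in `[0%R, +oo[) (x ^+ 2 / 2 * expR (- x))%:E = 1)%E.
Proof.
(* The antiderivative obtained by integrating by parts twice; it equals -1 at 0 and tends to 0 at
   infinity. *)
pose F (x : R) : R := - ((x ^+ 2 / 2 + x + 1) * expR (- x)).
have isdF (x : R) : is_derive x 1 F (x ^+ 2 / 2 * expR (- x)).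
  rewrite /F; apply: trigger_derive; rewrite /GRing.scale/=.
  by field.
have cF : continuous F.
  move=> x; apply: differentiable_continuous; apply/derivable1_diffP.
  exact: ex_derive.
rewrite (@ge0_continuous_FTC2y _ _ F _ 0).
- by rewrite -EFinB /F expr0n /= mul0r !add0r oppr0 expR0 mulr1 opprK.
- by move=> x x0; rewrite mulr_ge0 ?expR_ge0// divr_ge0 ?sqr_ge0.
- apply: continuous_subspaceT => x.
  apply: (@continuousM _ R^o (fun x => x ^+ 2 / 2) (fun x => expR (- x))).
    apply: (@continuousM _ R^o (fun x => x ^+ 2) (fun=> 2^-1)); last exact: cst_continuous.
    exact: exprn_continuous.
  by apply: continuous_comp; [exact: opp_continuous|exact: continuous_expR].
- by rewrite /F -oppr0; apply: cvgN; exact: quadratic_expRN_cvg0.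
- by move=> x _; exact: ex_derive.
- by apply: cvg_at_right_filter; exact: cF.
- by move=> x _; rewrite derive1E derive_val.
Qed.

(** The integrand is even, so the integral is twice that over the half-line, where the normalization
    [1 / 2] of the density gives the integrand [x ^+ 2 / 2 * expR (- x)]. *)
Lemma integral_sqr_laplace_pdf :
  (\int[mu]_x (x ^+ 2 * laplace_pdf 0 1 x)%:E = 2%:E)%E.
Proof.
rewrite (ge0_symfun_integralT (f := fun x => x ^+ 2 * laplace_pdf 0 1 x)).
- rewrite -set_itvcy -[RHS]mule1 -integral_itv_sqr_expRN; congr (_ * _)%E.
  apply: eq_integral => x; rewrite inE /= in_itv /= andbT => x0.
  by rewrite /laplace_pdf subr0 divr1 mulr1 ger0_norm// mulrA.
- by move=> x; rewrite mulr_ge0 ?sqr_ge0 ?laplace_pdf_ge0.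
- move=> x; apply: (@continuousM _ R^o (fun x => x ^+ 2)).
    exact: exprn_continuous.
  exact: continuous_laplace_pdf.
- by move=> x; rewrite /= sqrrN /laplace_pdf !subr0 normrN.
Qed.

(** Lebesgue measure is its own pushforward under negation. This supplies the symmetry behind the
    mean of a Laplace variable. *)
Lemma ge0_integralT_opp (f : R -> \bar R) :
  measurable_fun setT f -> (forall x, 0 <= f x)%E ->
  (\int[mu]_x f (- x)%R = \int[mu]_x f x)%E.
Proof.
move=> mf f0.
rewrite -[LHS]/(\int[mu]_(x in (-%R : _ -> measurableTypeR R) @^-1` setT) (f \o -%R) x)%E.
rewrite -ge0_integral_pushforward//.
by apply: eq_measure_integral => //= A mA _; exact: lebesgue_measureN.
Qed.

End laplace_standard_moments.

(** * Square integrability and moments of a Laplace random variable *)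

Section square_integrable.
Local Open Scope classical_set_scope.
Context {d} {T : measurableType d} {R : realType} (mu : {measure set T -> \bar R}).

Lemma sqr_integral_Lfun2 (f : T -> R) : measurable_fun setT f ->
  (\int[mu]_x (f x ^+ 2)%:E < +oo)%E -> f \in Lfun mu 2%:E.
Proof.
move=> mf foo; rewrite inE; apply/andP; split; first by rewrite inE.
rewrite inE /= /finite_norm unlock /= poweR_lty//.
rewrite (eq_integral (fun x => (f x ^+ 2)%:E))// => x _.
by rewrite /= powR_mulrn ?normr_ge0 // -normrX ger0_norm ?sqr_ge0.
Qed.

End square_integrable.

Section laplace_expectation.
Local Open Scope classical_set_scope.
Context {d} {Omega : measurableType d} {R : realType} {P : probability Omega R}.
Variables (X : {RV P >-> R}) (m s : R).
Hypotheses (s0 : 0 < s) (lapX : is_laplace X m s).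

(** Three changes of variables in a row: from [P] to the law of [X], from that law to Lebesgue
    measure with the Laplace density, and from there to the standard density. *)
Lemma ge0_expectation_laplace (f : R -> R) :
  continuous f -> (forall x, 0 <= f x) ->
  (\int[P]_w (f ((X w - m) / s))%:E =
   \int[lebesgue_measure]_y (f y * laplace_pdf 0 1 y)%:E)%E.
Proof.
move=> cf f0.
have mg : measurable_fun setT (fun x : R => f ((x - m) / s)).
  apply: measurableT_comp; first exact: continuous_measurable_fun.
  by apply: measurable_funM => //; exact: measurable_funB.
have mgE : measurable_fun setT (fun x : R => (f ((x - m) / s))%:E).
  exact/measurable_EFinP.
(* [lebesgue_measure] lives on [measurableTypeR R], whose display differs from
   that of [R], so [distribution P X] cannot be compared with it directly. *)
pose X' : Omega -> measurableTypeR R := X.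
have mX' : measurable_fun setT X' by exact: (@measurable_funPT _ _ _ _ X).
pose X'_mfun : {mfun Omega >-> measurableTypeR R} :=
  HB.pack X' (isMeasurableFun.Build _ _ _ _ X' mX').
rewrite -(ge0_integral_laplace_standardize f m s s0 cf f0).
transitivity (\int[pushforward P X'_mfun]_x (f ((x - m) / s))%:E)%E.
  by rewrite ge0_integral_pushforward// => x _; rewrite lee_fin.
apply: (@ge0_integral_density _ _ _ (pushforward P X'_mfun) lebesgue_measure
  (laplace_pdf m s)  _ _ _ (fun x => (f ((x - m) / s))%:E)).
- by apply: continuous_measurable_fun; exact: continuous_laplace_pdf.
- by move=> x; exact: laplace_pdf_ge0.
- exact: lapX.
- exact: mgE.
- by move=> x; rewrite lee_fin.
Qed.

Lemma second_moment_laplace :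
  (\int[P]_w ((X w - m) ^+ 2)%:E = (2 * s ^+ 2)%:E)%E.
Proof.
have mX : measurable_fun setT (fun w => (((X w - m) / s) ^+ 2)%:E).
  apply/measurable_EFinP/measurable_funX/measurable_funM => //.
  exact: measurable_funB.
have sqE w : ((X w - m) ^+ 2)%:E = ((s ^+ 2)%:E * (((X w - m) / s) ^+ 2)%:E)%E.
  by rewrite -EFinM -exprMn mulrC divfK// gt_eqF.
rewrite (eq_integral _ _ (fun w _ => sqE w)) ge0_integralZl//; last 2 first.
- by move=> w _; rewrite lee_fin sqr_ge0.
- by rewrite lee_fin sqr_ge0.
rewrite (@ge0_expectation_laplace (fun x => x ^+ 2))//; last 2 first.
- exact: exprn_continuous.
- by move=> x; exact: sqr_ge0.
by rewrite integral_sqr_laplace_pdf -EFinM mulrC.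
Qed.

Lemma laplace_centered_Lfun2 : (fun w => X w - m) \in Lfun P 2%:E.
Proof.
apply: sqr_integral_Lfun2; first exact: measurable_funB.
by rewrite second_moment_laplace ltry.
Qed.

(** The transfer to the standard density is available for nonnegative functions, so the positive and
    negative parts of the standardized variable are treated separately. They have equal integrals
    because the density is even, and square integrability makes the common value finite, so the
    difference is 0. *)
Lemma mean_laplace : (\int[P]_w (X w - m)%:E = 0)%E.
Proof.
have Pfin : P setT \is a fin_num by exact: fin_num_measure.
pose Z w := (X w - m) / s.
have YZ w : (X w - m)%:E = (s%:E * (Z w)%:E)%E.
  by rewrite -EFinM mulrC divfK// gt_eqF.
have ZE : Z = s^-1 \o* (fun w => X w - m) by [].
have Z1 : P.-integrable setT (EFin \o Z).
  apply/Lfun1_integrable; apply: (Lfun_subset12 Pfin).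
  by rewrite ZE; apply: Lfun_scale; [exact: ler1n|exact: laplace_centered_Lfun2].
rewrite (eq_integral _ _ (fun w _ => YZ w)) integralZl//.
suff -> : (\int[P]_w (Z w)%:E = 0)%E by rewrite mule0.
(* The positive part is written as a continuous nonnegative function of [Z], the form required by
   [ge0_expectation_laplace]. *)
have cmax : continuous (fun x : R => Num.max x 0).
  by move=> x; apply: continuous_max; [exact: cvg_id|exact: cst_continuous].
have max_ge0 (x : R) : 0 <= Num.max x 0 by rewrite le_max lexx orbT.
rewrite integralE.
have posE : (\int[P]_w (fun x => (Z x)%:E)^\+ w =
    \int[lebesgue_measure]_y (Num.max y 0 * laplace_pdf 0 1 y)%:E)%E.
  rewrite -(ge0_expectation_laplace _ cmax max_ge0).
  by apply: eq_integral => w _; rewrite funeposE -EFin_max.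
have -> : (\int[P]_w (fun x => (Z x)%:E)^\- w =
    \int[lebesgue_measure]_y (Num.max (- y) 0 * laplace_pdf 0 1 y)%:E)%E.
  have cmaxN : continuous (fun x : R => Num.max (- x) 0).
    have cN : continuous (fun x : R => - x) by move=> x; exact: opp_continuous.
    by move=> x; exact: (continuous_comp (cN x) (cmax (- x))).
  rewrite -(ge0_expectation_laplace _ cmaxN (fun x => max_ge0 (- x))).
  by apply: eq_integral => w _; rewrite funenegE -EFinN -EFin_max.
have mmax : measurable_fun setT
    (fun x : measurableTypeR R => (Num.max x 0 * laplace_pdf 0 1 x)%:E).
  apply/measurable_EFinP/measurable_funM.
    exact: continuous_measurable_fun.
  by apply: continuous_measurable_fun; exact: continuous_laplace_pdf.
set A := (X in _ = X) in posE; set B := (X in (_ - X)%E).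
have AB : B = A.
  rewrite /A -(ge0_integralT_opp _ mmax) => [|x]; last first.
    by rewrite lee_fin mulr_ge0 ?max_ge0 ?laplace_pdf_ge0.
  by apply: eq_integral => x _; rewrite /laplace_pdf !subr0 normrN.
by rewrite posE AB subee// -posE integrable_pos_fin_num.
Qed.

End laplace_expectation.

Section laplace_variance.
Local Open Scope ereal_scope.
Context {d} {Omega : measurableType d} {R : realType} {P : probability Omega R}.
Variables (X : {RV P >-> R}) (m s : R).
Hypotheses (s0 : (0 < s)%R) (lapX : is_laplace X m s).

Lemma laplace_Lfun2 : (X : Omega -> R) \in Lfun P 2%:E.
Proof.
have -> : (X : Omega -> R) = ((fun w => X w - m) \+ cst m)%R.
  by apply/funext => w /=; rewrite subrK.
rewrite rpredD ?lee1n//= ?Lfun_cst//.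
move=> ?; exact: (laplace_centered_Lfun2 X m s s0 lapX).
Qed.

Lemma expectation_laplace : 'E_P[X] = m%:E.
Proof.
have Pfin : P setT \is a fin_num by exact: fin_num_measure.
have -> : (X : Omega -> R) = ((fun w => X w - m) \+ cst m)%R.
  by apply/funext => w /=; rewrite subrK.
rewrite expectationD; last 2 first.
- exact/(Lfun_subset12 Pfin)/(laplace_centered_Lfun2 X m s s0 lapX).
- exact: Lfun_cst.
by rewrite expectation_cst unlock (mean_laplace X m s s0 lapX) add0e.
Qed.

Lemma variance_laplace : 'V_P[X] = (2 * s ^+ 2)%:E.
Proof.
rewrite /variance unlock expectation_laplace unlock.
rewrite -(second_moment_laplace X m s s0 lapX).
by apply: eq_integral => w _.
Qed.

End laplace_variance.

(** * Independent square-integrable variables are uncorrelated *)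

Section independent_pair.
Local Open Scope classical_set_scope.
Local Open Scope ereal_scope.
Context {d} {Omega : measurableType d} {R : realType} {P : probability Omega R}.
Variables X Y : {RV P >-> R}.
Hypothesis indXY : forall A B : set R, measurable A -> measurable B ->
  P (X @^-1` A `&` Y @^-1` B) = P (X @^-1` A) * P (Y @^-1` B).
Hypotheses (X2 : (X : Omega -> R) \in Lfun P 2%:E).
Hypotheses (Y2 : (Y : Omega -> R) \in Lfun P 2%:E).

Let XY (w : Omega) : R * R := (X w, Y w).

Let mXY : measurable_fun setT XY.
Proof. by apply/measurable_fun_pairP; split; exact: measurable_funPT. Qed.

Let XY_mfun : {mfun Omega >-> (R * R)%type} :=
  HB.pack XY (isMeasurableFun.Build _ _ _ _ XY mXY).

(** The expectation of the product is an integral over the joint law, which is the product of the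
    marginal laws; Fubini then factors it. Square integrability of both factors makes their product
    integrable. *)
Lemma independent_expectationM : 'E_P[(X \* Y)%R] = 'E_P[X] * 'E_P[Y].
Proof.
have Pfin : P setT \is a fin_num by exact: fin_num_measure.
have X1 := Lfun_subset12 Pfin X2; have Y1 := Lfun_subset12 Pfin Y2.
have intXY : P.-integrable setT (EFin \o (X \* Y)%R).
  by apply/Lfun1_integrable; exact: Lfun2_mul_Lfun1.
have mf : measurable_fun setT (fun z : (R * R)%type => (z.1 * z.2)%R%:E).
  by apply/measurable_EFinP/measurable_funM.
(* By [indXY] the two measures agree on rectangles, which determine the product measure. *)
have jointE (A : set (R * R)%type) : measurable A ->
    (distribution P X \x distribution P Y) A = pushforward P XY_mfun A.
  by move=> mA; exact: product_measure_unique.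

rewrite unlock.
have -> : \int[P]_w ((X \* Y) w)%R%:E =
    \int[distribution P X \x distribution P Y]_z (z.1 * z.2)%R%:E.
  rewrite -[LHS](@integral_pushforward _ _ _ _ _ XY_mfun _ P setT
    (fun z : (R * R)%type => (z.1 * z.2)%R%:E))//.
  by apply: eq_measure_integral => A mA _; exact/esym/jointE.
have mE : measurable_fun [set: R] (fun x : R => x%:E) by exact/measurable_EFinP.
have intdistr (Z : {RV P >-> R}) : (Z : Omega -> R) \in Lfun P 1 ->
    (distribution P Z).-integrable setT (fun x : R => x%:E).
  by move=> /Lfun1_integrable Z1; exact: integrable_pushforward.
have edistr (Z : {RV P >-> R}) : (Z : Omega -> R) \in Lfun P 1 ->
    \int[distribution P Z]_x x%:E = \int[P]_w (Z w)%:E.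
  by move=> /Lfun1_integrable Z1; rewrite integral_distribution.
rewrite -integral12_prod_meas1//; last first.
  apply/integrableP; split=> //.
  rewrite (eq_measure_integral (pushforward P XY_mfun)); last first.
    by move=> A mA _; exact: jointE.
  have /integrableP[_] : (pushforward P XY_mfun).-integrable setT
      (fun z : (R * R)%type => (z.1 * z.2)%R%:E).
    exact: integrable_pushforward.
  by [].
have Yfin : \int[P]_w (Y w)%:E \is a fin_num.
  by apply: integrable_fin_num => //; exact/Lfun1_integrable.
(* For fixed [x] the inner integral of [x * y] over the law of [Y] is [x] times the mean of [Y]. *)
rewrite (eq_integral (fun x : R => \int[P]_w (Y w)%:E * x%:E)); last first.
  move=> x _; rewrite /fubini_F /=.
  under eq_integral do rewrite EFinM.
  by rewrite integralZl// ?edistr ?(muleC x%:E)//; exact: intdistr.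
rewrite -(fineK Yfin) integralZl//; last exact: intdistr.
by rewrite edistr// muleC.
Qed.

Lemma independent_covariance : covariance P X Y = 0.
Proof.
have Pfin : P setT \is a fin_num by exact: fin_num_measure.
have X1 := Lfun_subset12 Pfin X2; have Y1 := Lfun_subset12 Pfin Y2.
rewrite covarianceE ?Lfun2_mul_Lfun1// independent_expectationM subee//.
by rewrite fin_numM ?expectation_fin_num.
Qed.

End independent_pair.

(** * Variance of a sum of pairwise uncorrelated variables *)

Section variance_sum.
Context {d} {Omega : measurableType d} {R : realType} {P : probability Omega R}.
Context {I : eqType}.
Variable F : I -> Omega -> R.
Hypothesis F2 : forall i, F i \in Lfun P 2%:E.

Lemma Lfun2_sum (s : seq I) : \sum_(i <- s) F i \in Lfun P 2%:E.
Proof.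
elim: s => [|i s IHs]; first by rewrite big_nil; exact: Lfun_cst.
rewrite big_cons rpredD ?lee1n//= => ?; exact: F2.
Qed.

Lemma covariance_sum0 (s : seq I) (Y : Omega -> R) : Y \in Lfun P 2%:E ->
  {in s, forall i, covariance P (F i) Y = 0%E} ->
  covariance P (\sum_(i <- s) F i) Y = 0%E.
Proof.
move=> Y2; elim: s => [_|i s IHs cov0].
  by rewrite big_nil; exact: covariance_cst_l.
rewrite big_cons covarianceDl//; last exact: Lfun2_sum.
rewrite cov0 ?mem_head// IHs ?adde0// => j js.
by rewrite cov0// in_cons js orbT.
Qed.

Lemma variance_sum (s : seq I) : uniq s ->
  {in s &, forall i j, i != j -> covariance P (F i) (F j) = 0%E} ->
  variance P (\sum_(i <- s) F i) = (\sum_(i <- s) variance P (F i))%E.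
Proof.
elim: s => [_ _|i s IHs /= /andP[is_ us] cov0].
  by rewrite !big_nil; exact: variance_cst.
rewrite !big_cons varianceD//; last exact: Lfun2_sum.
(* By [uniq] the head index differs from every index of the tail, so the cross term vanishes. *)
rewrite covarianceC covariance_sum0// ?mule0 ?adde0 => [|j js]; last first.
  apply: cov0; rewrite ?mem_head ?in_cons ?js ?orbT//.
  by apply: contraNneq is_ => <-.
rewrite IHs// => j k js ks; apply: cov0; rewrite in_cons ?js ?ks orbT//.
Qed.

End variance_sum.

(** The product formula for the index set [{i, j}], with the event [A] at [i] and [B] at any other
    index; [i != j] keeps the two factors apart. *)
Lemma mutually_independent_pair {d} {Omega : measurableType d} {R : realType}
    {P : probability Omega R} {I : finType} (X : I -> {RV P >-> R}) (i j : I) :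
  mutually_independent X -> i != j ->
  forall A B : set R, measurable A -> measurable B ->
  P ((X i @^-1` A) `&` (X j @^-1` B))%classic =
  (P (X i @^-1` A)%classic * P (X j @^-1` B)%classic)%E.
Proof.
move=> indX ij A B mA mB.
have ji : (j == i) = false by rewrite eq_sym; exact: negbTE.
have := indX [set i; j]%SET (fun k => if k == i then A else B).
rewrite big_setU1 ?big_set1 ?inE//= eqxx ji => <-; last first.
  by move=> k _; case: ifP.
congr (P _); apply/seteqP; split=> w.
  move=> [wA wB] k /=; rewrite !inE => /orP[]/eqP ->; first by rewrite eqxx.
  by rewrite ji.
move=> H; split.
  by have := H i; rewrite /= eqxx; apply; rewrite !inE eqxx.
by have := H j; rewrite /= ji; apply; rewrite !inE eqxx orbT.
Qed.

(** * Which draw each array entry holds at the end *)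

Section last_draw.
Context {U : finType} {T m : nat}.
Variables (S : T.-tuple U) (M : m.-tuple U).

(** With [S] and [M] fixed, the index of the draw held by entry [i] is deterministic. The fold runs
    in the same order as [resample], so the two are compared step by step. *)
Definition last_draw (i : 'I_m) (s : seq 'I_T) : 'I_m + 'I_T :=
  foldl (fun k t => if tnth S t == tnth M i then inr t else k) (inl i) s.

Lemma last_drawP (i : 'I_m) (s : seq 'I_T) :
  match last_draw i s with
  | inl j => j = i /\ {in s, forall t, tnth S t != tnth M i}
  | inr t => t \in s /\ tnth S t = tnth M i
  end.
Proof.
elim/last_ind: s => [//|s t]; rewrite /last_draw foldl_rcons -/(last_draw i s).
case: ifPn => [/eqP St _|St]; first by rewrite mem_rcons mem_head.
case: (last_draw i s) => [j|t'] [].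
  move=> -> nS; split=> // t'; rewrite mem_rcons in_cons => /predU1P[->//|].
  exact: nS.
by move=> t's St'; rewrite mem_rcons in_cons t's orbT.
Qed.

(** An initial draw belongs to one entry, and a draw at step [t] goes to the entry of the user
    [tnth S t], which is unique when [M] has no repetition. Distinct entries therefore hold
    independent draws. *)
Lemma last_draw_inj (s : seq 'I_T) : uniq M -> injective (last_draw ^~ s).
Proof.
move=> /tuple_uniqP injM i j /= eqij.
move: (last_drawP i s) (last_drawP j s); rewrite eqij.
case: (last_draw j s) => [k|t]; first by move=> [<- _] [<- _].
by move=> [_ Si] [_ Sj]; apply: injM; rewrite -Si.
Qed.

Lemma foldl_resampleE (R : realType) (init : 'I_m -> R) (upd : 'I_T -> R)
    (noise : R) (s : seq 'I_T) (i : 'I_m) :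
  foldl (resample S M upd) init s i =
  all_draws init upd noise (inl (last_draw i s)).
Proof.
elim/last_ind: s => [//|s t IHs].
by rewrite /last_draw !foldl_rcons -/(last_draw i s) {1}/resample IHs; case: ifP.
Qed.

(** Without repetitions in [M], counting users amounts to counting positions, which matches the sum
    over array entries. *)
Lemma densityE (R : realType) : uniq M ->
  density R M S = m%:R^-1 * \sum_(i < m) (tnth M i \in S)%:R.
Proof.
move=> uM; rewrite /density mulrC; congr (_ * _).
rewrite -natr_sum; congr (_%:R).
have -> : [set u in M | u \in substream M S]%SET =
    [set tnth M i | i in [set i | tnth M i \in S]]%SET.
  apply/setP => u; rewrite !inE mem_filter; apply/andP/imsetP.
    by move=> [/tnthP[i ->] /andP[_ uS]]; exists i; rewrite ?inE.
  by move=> [i /[!inE] iS ->]; rewrite mem_tnth iS.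
rewrite card_imset; last exact/tuple_uniqP.
by rewrite -sum1dep_card big_mkcond; apply: eq_bigr => i _; case: ifP.
Qed.

Lemma mem_last_draw (i : 'I_m) :
  (tnth M i \in S) = if last_draw i (enum 'I_T) is inr _ then true else false.
Proof.
move: (last_drawP i (enum 'I_T)); case: (last_draw _ _) => [j|t] [].
  move=> _ nS; apply/negbTE/negP => /tnthP[t Mt].
  by have := nS t; rewrite mem_enum Mt eqxx => /(_ isT).
by move=> _ <-; rewrite mem_tnth.
Qed.

End last_draw.

(** * Mean and mean squared error of the estimator *)

Theorem theorem4p8 (R : realType) (U : finType) (T m : nat)
    (S : T.-tuple U) (M : m.-tuple U) (eps mu_init mu_upd : R)
    (d : measure_display) (Omega : measurableType d) (P : probability Omega R)
    (init : 'I_m -> {RV P >-> R}) (upd : 'I_T -> {RV P >-> R})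
    (noise : {RV P >-> R}) :
  (0 < m)%N -> uniq M ->
  0 < eps -> eps <= 2^-1 ->
  mu_init < mu_upd ->
  let b := (mu_upd - mu_init) / eps in
  (forall i : 'I_m, is_laplace (init i) mu_init b) ->
  (forall t : 'I_T, is_laplace (upd t) mu_upd b) ->
  is_laplace noise 0 (1 / (eps * m%:R)) ->
  mutually_independent (all_draws init upd noise) ->
  let dtilde : Omega -> R := fun w =>
    laplace_density_estimator S M mu_init mu_upd
      (fun i => init i w) (fun t => upd t w) (noise w) in
  expectation P dtilde = (density R M S)%:E /\
  expectation P (fun w => (dtilde w - density R M S) ^+ 2) =
    (2 * (m%:R + 1) / (m%:R ^+ 2 * eps ^+ 2))%:E.
Proof.
move=> m0 uM eps0 _ mu_lt b init_lap upd_lap noise_lap indep dtilde.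
have m0R : 0 < m%:R :> R by rewrite ltr0n.
have D0 : 0 < mu_upd - mu_init by rewrite subr_gt0.
have b0 : 0 < b by rewrite divr_gt0.
have s0 : 0 < 1 / (eps * m%:R) by rewrite divr_gt0// mulr_gt0.
have Pfin : P setT \is a fin_num by exact: fin_num_measure.
pose k i := last_draw S M i (enum 'I_T).
pose X := all_draws init upd noise.
pose mean i := mu_init + (mu_upd - mu_init) * (tnth M i \in S)%:R.
pose F i : Omega -> R := X (inl (k i)).
(* Both kinds of draws have scale [b]; the location is [mu_upd] exactly when [k i] is a stream step,
   that is when the user occurs in [S]. *)
have lapF i : is_laplace (X (inl (k i))) (mean i) b.
  rewrite /mean mem_last_draw -/(k i) /X; case: (k i) => [j|t] /=.
    by rewrite mulr0 addr0; exact: init_lap.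
  by rewrite mulr1 addrC subrK; exact: upd_lap.
have F2 i : F i \in Lfun P 2%:E by exact: (laplace_Lfun2 _ _ _ b0 (lapF i)).
have noise2 : (noise : Omega -> R) \in Lfun P 2%:E.
  exact: (laplace_Lfun2 _ _ _ s0 noise_lap).
have covX j l : j != l -> (X j : Omega -> R) \in Lfun P 2%:E ->
    (X l : Omega -> R) \in Lfun P 2%:E -> covariance P (X j) (X l) = 0%E.
  move=> jl Xj2 Xl2; apply: independent_covariance => //.
  exact: mutually_independent_pair.
pose W := \sum_(i < m) F i.
pose c := (mu_upd - mu_init)^-1 / m%:R.
have W2 : W \in Lfun P 2%:E by exact: Lfun2_sum.
have cW2 : c \o* W \in Lfun P 2%:E by rewrite Lfun_scale// ler1n.
(* The noiseless part of the estimate, as an affine function of the sum [W] of the entries. *)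
pose Z := (c \o* W \+ cst (- ((mu_upd - mu_init)^-1 * mu_init)))%R.
have Z2 : Z \in Lfun P 2%:E by rewrite rpredD ?lee1n//= ?Lfun_cst.
have dtildeE : dtilde = (Z \+ noise)%R.
  apply/funext => w; rewrite /dtilde /laplace_density_estimator /Z /c /W /=.
  rewrite fct_sumE (eq_bigr (fun i => F i w)) => [|i _]; first by ring.
  rewrite /final_array (foldl_resampleE _ _ _ _ _ (noise w)) -/(k i) /F /X.
  by case: (k i).
have Edtilde : expectation P dtilde = (density R M S)%:E.
  rewrite dtildeE expectationD; last 2 first.
  - exact: Lfun_subset12 Z2.
  - exact: Lfun_subset12 noise2.
  rewrite expectationD; last 2 first.
  - exact: Lfun_subset12 cW2.
  - exact: Lfun_cst.
  rewrite expectationZl; last exact: Lfun_subset12 W2.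
  rewrite expectation_cst (expectation_laplace _ _ _ s0 noise_lap) adde0.
  rewrite /W -(big_map F xpredT id) expectation_sum => [|f /mapP[i _ ->]]; last first.
    exact: Lfun_subset12 (F2 i).
  rewrite big_map.
  under eq_bigr do rewrite (expectation_laplace _ _ _ b0 (lapF _)).
  rewrite sumEFin -EFinM -EFinD densityE//; congr EFin.
  rewrite /mean big_split /= -mulr_sumr sumr_const card_ord -mulr_natr /c.
  by field; rewrite !gt_eqF.
split=> //.
(* Unbiasedness turns the mean squared error into the variance. *)
have -> : expectation P (fun w => (dtilde w - density R M S) ^+ 2) = variance P dtilde.
  by rewrite /variance covariance.unlock Edtilde.
(* The noise has index [inr tt], distinct from every [inl (k i)]. *)
have covWn : covariance P W noise = 0%E.
  apply: covariance_sum0 => // i _.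
  by apply: (covX (inl (k i)) (inr tt)) => //; exact: F2.
rewrite dtildeE varianceD// /Z varianceD_cst_r// varianceZ//.
rewrite covarianceDl ?Lfun_cst// covariance_cst_l adde0.
rewrite covarianceZl; last 3 first.
- exact: Lfun_subset12 W2.
- exact: Lfun_subset12 noise2.
- exact: Lfun2_mul_Lfun1.
rewrite covWn !mule0 adde0 (variance_laplace _ _ _ s0 noise_lap).
rewrite /W variance_sum => [|//|//|i j _ _ ij]; last 2 first.
- exact: index_enum_uniq.
- apply: covX; [|exact: F2|exact: F2].
  by apply: contra_neq ij => -[] /last_draw_inj; exact.
under eq_bigr do rewrite (variance_laplace _ _ _ b0 (lapF _)).
rewrite sumEFin -EFinM -EFinD; congr EFin.
(* The entries contribute [2 / (m * eps ^+ 2)] and the noise [2 / (m ^+ 2 * eps ^+ 2)]. *)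
rewrite sumr_const card_ord -mulr_natr /c /b.
by field; rewrite !gt_eqF.
Qed.
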